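(* Let $q=2^e$ with $e\ge3$ odd, $\sigma=2^{\frac{e+1}{2}}$, and let $\varepsilon\in\mathbb{F}_{q^2}\setminus\mathbb{F}_q$ satisfy $\varepsilon^2+\varepsilon+\delta=0$ with $\delta\in\mathbb{F}_q\setminus\{1\}$, $\mathrm{Tr}_{q/2}(\delta)=1$. Let $\mathcal{V}^3_\varepsilon$ be the surface of $\mathrm{PG}(3,q^2)$ with affine equation $x_3^q+x_3=\Gamma_\varepsilon(x_1)+\Gamma_\varepsilon(x_2)$. Then the following hold: (1) any line of $\mathrm{PG}(3,q^2)$ contained in $\mathcal{V}^3_\varepsilon$ contains at least one of the points $L_\infty^{\varepsilon^q\alpha}=(0,1,1,\varepsilon^q\alpha)$ with $\alpha\in\mathbb{F}_q$; (2) through any point $L_\infty^{\varepsilon^q\alpha}$ ($\alpha\in\mathbb{F}_q$) there are exactly $q+1$ coplanar lines contained in $\mathcal{V}^3_\varepsilon$, one of these being $\ell_\infty$. Each such set of $q+1$ lines is a Hermitian cone $\Pi_0\mathcal{H}(1,q^2)$; (3) the only lines contained in $\mathcal{V}^3_\varepsilon$ through $P_\infty=(0,0,0,1)$ are $\ell_\infty$ if $e\equiv1\pmod4$, and $\ell_\infty,\ell_1,\ell_2$ if $e\equiv3\pmod4$.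
   Context: Points of $\mathrm{PG}(3,q^2)$ have homogeneous coordinates $(X_0,X_1,X_2,X_3)$ and affine coordinates $x_i=X_i/X_0$ when $X_0\neq0$; $\Pi_\infty$ is the plane $X_0=0$. In exponents, $\sigma$ denotes the integer $2^{(e+1)/2}$. $\mathrm{Tr}_{q/2}$ is the absolute trace of $\mathbb{F}_q$. Put $$\Gamma_\varepsilon(x)=[x+(x^q+x)\varepsilon]^{\sigma+2}+(x^q+x)^\sigma+(x^{2q}+x^2)\varepsilon+x^{q+1}+x^2 .$$ $\mathcal{V}^3_\varepsilon$ denotes the set of $\mathbb{F}_{q^2}$-rational points of the projective surface with the given affine equation, i.e. of the zero locus of its homogenization with respect to $X_0$ (points on $\Pi_\infty$ included). $\ell_\infty$ is the line $X_0=X_1+X_2=0$. When $e\equiv3\pmod4$, $\ell_i$ ($i=1,2$) is the line $X_0=X_1+w_iX_2=0$, where $w_1,w_2$ are the $(2^{\frac{e-1}{2}}+1)$-th roots of unity in $\mathbb{F}_{q^2}$ different from $1$ (there are exactly two of them). A Hermitian cone $\Pi_0\mathcal{H}(1,q^2)$ in a plane is the join of a point $\Pi_0$ (the vertex) to a non-singular Hermitian variety $\mathcal{H}(1,q^2)$ (equivalently, a Baer subline, of $q+1$ points) of a line of that plane not through $\Pi_0$.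
   Formalization: Part (1) as stated fails for e≡3 (mod 4), since ℓ_1 and ℓ_2 lie on the surface by (3) but contain no point (0,1,1,ε^qα); the formal version of (1) excepts exactly the lines ℓ_1, ℓ_2 when e≡3 (mod 4). *)

(* Defs.v *)
From HB Require Import structures.
From mathcomp Require Import all_boot all_order all_algebra all_field.
From mathcomp.multinomials Require Import mpoly.

Set Implicit Arguments.
Unset Strict Implicit.
Unset Printing Implicit Defensive.

Import GRing.Theory.
Local Open Scope ring_scope.

Section ProjectiveSpace.
Variable F : finFieldType.

(* A subspace of PG(3, F) is a linear subspace of F^4, of dimension one more. *)
Notation subsp := {vspace 'rV[F]_4}.

Definition is_point (P : subsp) : Prop := \dim P = 1%N.
Definition is_line (L : subsp) : Prop := \dim L = 2%N.
Definition is_plane (S : subsp) : Prop := \dim S = 3%N.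

Definition vec4 (a b c d : F) : 'rV[F]_4 := \row_i [:: a; b; c; d]`_i.

Definition hpoint (a b c d : F) : subsp := <[vec4 a b c d]>%VS.

(* The solutions X of a X_0 + b X_1 + c X_2 + d X_3 = 0. *)
Definition hplane (a b c d : F) : subsp :=
  lker (linfun (mulmxr (vec4 a b c d)^T : 'rV[F]_4 -> 'rV[F]_1)).

Definition in_zeros (p : {mpoly F[4]}) (P : subsp) : Prop :=
  forall v : 'rV[F]_4, v \in P -> v != 0 -> p.@[v 0] = 0.

Definition contained_in_zeros (p : {mpoly F[4]}) (L : subsp) : Prop :=
  forall P : subsp, is_point P -> (P <= L)%VS -> in_zeros p P.

(* H is a non-singular Hermitian variety H(1, q^2) of the line M: in a frame  *)
(* b of M, its points have coordinates c with c A (c^q)^T = 0, where A is an  *)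
(* invertible matrix such that A = (A^T)^q.                                   *)
Definition hermitian_variety_of_line (q : nat) (M : subsp) (H : subsp -> Prop)
  : Prop :=
  exists (b : 2.-tuple 'rV[F]_4) (A : 'M[F]_2),
    [/\ basis_of M b,
        A \is hermitianmx 2 false (fun x : F => x ^+ q),
        A \in unitmx &
        forall P : subsp, H P <->
          exists c : 'rV[F]_2,
            [/\ c != 0, P = <[\sum_i c 0 i *: tnth b i]>%VS &
                form_of_matrix (fun x : F => x ^+ q) A c c = 0]].

(* S is the set of points of a Hermitian cone with vertex Q in the plane Pi. *)
Definition hermitian_cone (q : nat) (Pi Q : subsp) (S : subsp -> Prop) : Prop :=
  [/\ is_plane Pi, is_point Q, (Q <= Pi)%VS &
      exists (M : subsp) (H : subsp -> Prop),
        [/\ is_line M, (M <= Pi)%VS, ~~ (Q <= M)%VS,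
            hermitian_variety_of_line q M H &
            forall P : subsp, is_point P ->
              (S P <-> exists2 R : subsp, H R & (P <= Q + R)%VS)]].

End ProjectiveSpace.

(* The variables of p are x_1, ..., x_n; the new variable X_0 has index 0.    *)
(* Recall that msize p is one more than the total degree of p.                *)
Definition homogenize (R : comNzRingType) (n : nat) (p : {mpoly R[n]}) :
    {mpoly R[n.+1]} :=
  \sum_(m <- msupp p)
    p@_m *: ('X_ord0 ^+ ((msize p).-1 - mdeg m)
             * \prod_(i < n) 'X_(lift ord0 i) ^+ m i).

Section Surface.
Variables (F : finFieldType) (e : nat).

Definition qe : nat := (2 ^ e)%N.
Definition sigma : nat := (2 ^ e.+1./2)%N.

Definition in_Fq (x : F) : Prop := x ^+ qe = x.

Definition abs_trace (x : F) : F := \sum_(i < e) x ^+ (2 ^ i)%N.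

Definition Gamma (eps : F) (x : {mpoly F[3]}) : {mpoly F[3]} :=
  (x + (x ^+ qe + x) * eps%:MP) ^+ (sigma + 2)%N + (x ^+ qe + x) ^+ sigma
  + (x ^+ (2 * qe)%N + x ^+ 2) * eps%:MP + x ^+ (qe + 1)%N + x ^+ 2.

Definition affine_surface (eps : F) : {mpoly F[3]} :=
  let x1 := 'X_(inord 0) in let x2 := 'X_(inord 1) in let x3 := 'X_(inord 2) in
  x3 ^+ qe + x3 - (Gamma eps x1 + Gamma eps x2).

Definition line_in_V (eps : F) (L : {vspace 'rV[F]_4}) : Prop :=
  is_line L /\ contained_in_zeros (homogenize (affine_surface eps)) L.

(* The line X_0 = X_1 + w X_2 = 0; ell 1 is the line l_infinity. *)
Definition ell (w : F) : {vspace 'rV[F]_4} :=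
  capv (hplane 1 0 0 0) (hplane 0 1 w 0).

(* When e = 3 mod 4, there are exactly two such w, and the lines ell w are    *)
(* contained in the surface. They lie in X_0 = 0 and meet X_1 = X_2 only in   *)
(* P_infty, so they contain none of the points L_infty eps alpha.             *)
Definition nontrivial_root (w : F) : Prop :=
  (2 ^ e.-1./2 + 1)%N.-unity_root w /\ w <> 1.

Definition L_infty (eps alpha : F) : {vspace 'rV[F]_4} :=
  hpoint 0 1 1 (eps ^+ qe * alpha).

Definition P_infty : {vspace 'rV[F]_4} := hpoint 0 0 0 1.

End Surface.

(* Main.v *)
Require Import Defs.
From HB Require Import structures.
From mathcomp Require Import all_boot all_order all_algebra all_field.
From mathcomp Require Import ring zify.
From mathcomp.multinomials Require Import mpoly.

(** Write the elements of F_(q^2) as a + b eps with a, b in F_q, and let s be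
    sigma. As eps^q = eps + 1, the trace x^q + x of x = a + b eps is b, and
    Gamma collapses to a^(s+2) + a b + b^s, which lies in F_q: it is the form
    that defines the Lueneburg-Tits ovoid ([trace_coord], [Gamma_coord]). An
    affine point is on the surface when the second coordinate of x_3 is the sum
    of the values of this form at x_1 and x_2.

    At infinity the equation reduces to its part of top degree q (s + 2), which
    is eps^(s+2) (X_1^(q(s+2)) + X_2^(q(s+2))). Put h = 2^((e-1)/2), so that
    s + 2 = 2 (h + 1). In characteristic 2 the points at infinity are those with
    X_1^(h+1) = X_2^(h+1), and the lines among them are the lines ell w with
    w^(h+1) = 1, all of which pass through P_infty ([line_at_infinity]). Since
    2 h^2 = q, such a w satisfies w^q = w^2, hence w^4 = w and w^3 = 1; whether
    a cube root of unity other than 1 qualifies depends on h mod 3, that is on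
    e mod 4.

    Any other line of the surface has the form t |-> (w t + c, t, v t + d) with
    w^(h+1) = 1, and it is on the surface exactly when
    Tr (v t + d) = Gamma (w t + c) + Gamma t for all t. For t in F_q this is a
    polynomial identity of degree s + 2 < q, so all coefficients vanish
    ([vanishing_on_Fq]).
    If w <> 1, then w = w0 + eps with w0 in F_q, and the leading coefficient
    gives w0^(s+2) = 1. This forces w0 = 1 and hence delta = 1, a contradiction
    ([secant_direction_neq1]).
    If w = 1, the coefficients give c = al eps, v = eps^q al and
    d = d0 + al^s eps with al in F_q, and d0 is an arbitrary element of F_q
    ([secant_direction1], [secant_on_surface1]). So the point L_infty al lies on
    q such lines, all in the plane X_1 + X_2 = al eps X_0. Together with ell 1
    they meet the line X_2 = 0 of this plane in the points (1, al eps, 0, d) with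
    d - al^s eps in F_q and in P_infty, a Baer subline. *)

Set Implicit Arguments.
Unset Strict Implicit.
Unset Printing Implicit Defensive.

Import GRing.Theory.
Local Open Scope ring_scope.

(** * Values of a homogenization *)

Section Homogenization.
Variables (R : idomainType) (n : nat).
Implicit Types (p r : {mpoly R[n]}).

Lemma homogenizeE p (X : 'I_n.+1 -> R) :
  (homogenize p).@[X] = \sum_(m <- msupp p)
    p@_m * (X ord0 ^+ ((msize p).-1 - mdeg m)
            * \prod_(i < n) X (lift ord0 i) ^+ m i).
Proof.
rewrite /homogenize rmorph_sum /=; apply: eq_bigr => m _.
rewrite mevalZ mevalM rmorphXn rmorph_prod /= mevalXU.
by congr (_ * (_ * _)); apply: eq_bigr => i _; rewrite rmorphXn /= mevalXU.
Qed.

Lemma homogenize_affine p (X : 'I_n.+1 -> R) (x : 'I_n -> R) :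
    (forall i, X (lift ord0 i) = x i * X ord0) ->
  (homogenize p).@[X] = X ord0 ^+ (msize p).-1 * p.@[x].
Proof.
move=> Xx; rewrite homogenizeE mevalE big_distrr /= !big_seq.
apply: eq_bigr => m m_p; rewrite [RHS]mulrCA; congr (_ * _).
have le_m : (mdeg m <= (msize p).-1)%N by have := msize_mdeg_lt m_p; lia.
rewrite -[in RHS](subnK le_m) exprD -mulrA; congr (_ * _).
rewrite (eq_bigr (fun i => x i ^+ m i * X ord0 ^+ m i)); last first.
  by move=> i _; rewrite Xx exprMn.
by rewrite big_split /= mulrC prodrXr mdegE.
Qed.

(** The restriction of p to the line through the origin in the direction x. Its
    coefficient of degree d is the value at x of the homogeneous part of degree
    d of p, and [along_ray x] is a ring morphism: parts of p of a given degree
    can be computed without expanding p into monomials. *)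
Definition along_ray (x : 'I_n -> R) (p : {mpoly R[n]}) : {poly R} :=
  mmap polyC (fun i => x i *: 'X) p.

Lemma coef_along_ray x p d :
  (along_ray x p)`_d =
    \sum_(m <- msupp p) p@_m * ((mdeg m == d)%:R * \prod_(i < n) x i ^+ m i).
Proof.
rewrite /along_ray /mmap coef_sum; apply: eq_bigr => m _.
rewrite coefCM; congr (_ * _); rewrite /mmap1.
rewrite (eq_bigr (fun i => (x i ^+ m i)%:P * 'X^(m i))); last first.
  by move=> i _; rewrite exprZn mul_polyC.
by rewrite big_split /= -rmorph_prod prodrXr -mdegE coefCM coefXn mulrC eq_sym.
Qed.

(** At X_0 = 0 only the monomials of top degree survive, because the others
    carry a positive power of X_0. *)
Lemma homogenize_infinity p (X : 'I_n.+1 -> R) : X ord0 = 0 ->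
  (homogenize p).@[X] =
    (along_ray (fun i => X (lift ord0 i)) p)`_(msize p).-1.
Proof.
move=> X0; rewrite homogenizeE coef_along_ray !big_seq.
apply: eq_bigr => m m_p; congr (_ * (_ * _)).
have le_m : (mdeg m <= (msize p).-1)%N by have := msize_mdeg_lt m_p; lia.
by rewrite X0 expr0n subn_eq0 eqn_leq le_m.
Qed.

Lemma coef_along_ray_eq0 x p d : (msize p <= d)%N -> (along_ray x p)`_d = 0.
Proof.
move=> le_pd; rewrite coef_along_ray big_seq big1 // => m m_p.
case: eqP => [def_d|_]; last by rewrite mul0r mulr0.
by have := msize_mdeg_lt m_p; rewrite def_d ltnNge le_pd.
Qed.

Lemma msizeM_leq p r a b :
  (msize p <= a.+1)%N -> (msize r <= b.+1)%N -> (msize (p * r) <= (a + b).+1)%N.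
Proof.
move=> le_p le_r.
have [->|p_nz] := eqVneq p 0; first by rewrite mul0r msize0.
have [->|r_nz] := eqVneq r 0; first by rewrite mulr0 msize0.
by rewrite msizeM //; lia.
Qed.

Lemma msizeX_leq p a k : (msize p <= a.+1)%N -> (msize (p ^+ k) <= (a * k).+1)%N.
Proof.
move=> le_p; elim: k => [|k IHk]; first by rewrite expr0 msize1.
by rewrite exprS mulnS msizeM_leq.
Qed.

Lemma msizeD_leq p r a :
  (msize p <= a)%N -> (msize r <= a)%N -> (msize (p + r) <= a)%N.
Proof.
by move=> le_p le_r; rewrite (leq_trans (msizeD_le _ _)) // geq_max le_p.
Qed.

End Homogenization.

Lemma coefM_top (R : nzRingType) (p r : {poly R}) a b :
    (size p <= a.+1)%N -> (size r <= b.+1)%N ->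
  (p * r)`_(a + b) = p`_a * r`_b.
Proof.
move=> le_p le_r; have lt_a : (a < (a + b).+1)%N by rewrite ltnS leq_addr.
rewrite coefM (bigD1 (Ordinal lt_a)) //= addKn big1 ?addr0 // => i ne_ia.
have {}ne_ia : i != a :> nat by [].
have [lt_ia|le_ai] := ltnP i a.
  rewrite [r`__]nth_default ?mulr0 // (leq_trans le_r) //.
  lia.
rewrite nth_default ?mul0r // (leq_trans le_p) //; lia.
Qed.

Lemma coefX_top (R : idomainType) (p : {poly R}) a k : (size p <= a.+1)%N ->
  (p ^+ k)`_(a * k) = p`_a ^+ k.
Proof.
move=> le_p; elim: k => [|k IHk]; first by rewrite muln0 coef1.
rewrite !exprS mulnS coefM_top ?IHk //.
have := size_exp_leq p k; have [->|p_nz] := eqVneq p 0.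
  by rewrite expr0n; case: k {IHk} => [|k]; rewrite ?size_poly0 ?size_poly1.
move=> /leq_trans; apply; rewrite ltnS leq_mul2r; apply/orP; right; lia.
Qed.

(** * The polynomial of the surface and its part of top degree *)

Section SurfacePolynomial.
Variables (F : finFieldType) (e : nat) (eps : F).
Hypotheses (e_gt0 : (0 < e)%N) (eps_nz : eps != 0).
Local Notation q := (qe e).
Local Notation s := (sigma e).
Implicit Types (x : 'I_3 -> F).

Lemma qe_gt1 : (1 < q)%N.
Proof. by rewrite /qe -(expn0 2) ltn_exp2l. Qed.

Lemma sigma_gt0 : (0 < s)%N.
Proof. by rewrite /sigma expn_gt0. Qed.

(** The only summand of Gamma of degree q (s + 2). *)
Definition Gamma_top (x : {mpoly F[3]}) : {mpoly F[3]} :=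
  (x + (x ^+ q + x) * eps%:MP) ^+ (s + 2)%N.

Lemma msize_var i : (msize ('X_i : {mpoly F[3]}) <= 1.+1)%N.
Proof. by rewrite msizeX mdeg1. Qed.

Lemma msize_varX i k : (msize ('X_i ^+ k : {mpoly F[3]}) <= k.+1)%N.
Proof. by rewrite -{2}[k]mul1n msizeX_leq ?msize_var. Qed.

Lemma msizeMC_leq (p : {mpoly F[3]}) c a :
  (msize p <= a.+1)%N -> (msize (p * c%:MP) <= a.+1)%N.
Proof. by move=> le_p; rewrite -[a]addn0 msizeM_leq // msizeC leq_b1. Qed.

Lemma msize_Gamma_top i : (msize (Gamma_top 'X_i) <= (q * (s + 2)).+1)%N.
Proof.
have [q_gt1 X1] := (qe_gt1, msize_var i).
apply: msizeX_leq; apply: msizeD_leq; first by apply: leq_trans X1 _; lia.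
apply: msizeMC_leq; apply: msizeD_leq; first exact: msize_varX.
by apply: leq_trans X1 _; lia.
Qed.

Lemma msize_Gamma_low i :
  (msize (Gamma e eps 'X_i - Gamma_top 'X_i) <= q * (s + 2))%N.
Proof.
have [[q_gt1 s_gt0] X1] := (qe_gt1, sigma_gt0, msize_var i).
rewrite /Gamma -/(Gamma_top _) [_ - _]addrC !addrA addNr add0r.
do 3?apply: msizeD_leq.
- apply: (@leq_trans (q * s).+1); last by lia.
  apply: msizeX_leq; apply: msizeD_leq; first exact: msize_varX.
  by apply: leq_trans X1 _; lia.
- apply: (@leq_trans (2 * q).+1); last by nia.
  apply: msizeMC_leq; apply: msizeD_leq; first exact: msize_varX.
  by apply: leq_trans (msize_varX _ _) _; lia.
- by apply: leq_trans (msize_varX _ _) _; nia.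
- by apply: leq_trans (msize_varX _ _) _; nia.
Qed.

Lemma along_ray_var x i : along_ray x 'X_i = x i *: 'X.
Proof. by rewrite /along_ray mmapX mmap1U. Qed.

Lemma coef_along_ray_Gamma_top x i :
  (along_ray x (Gamma_top 'X_i))`_(q * (s + 2)) = (eps * x i ^+ q) ^+ (s + 2).
Proof.
have q_gt1 := qe_gt1.
have -> : along_ray x (Gamma_top 'X_i) =
    (x i *: 'X + ((x i *: 'X) ^+ q + x i *: 'X) * eps%:P) ^+ (s + 2).
  have XE := along_ray_var x i; rewrite /along_ray in XE *.
  by rewrite /Gamma_top !(rmorphXn, rmorphD, rmorphM) /= XE mmapC.
rewrite coefX_top; last first.
  rewrite exprZn mulrC mul_polyC scalerDr !scalerA addrCA -scalerDl.
  rewrite (leq_trans (size_polyD _ _)) // geq_max !(leq_trans (size_scale_leq _ _)) //.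
    by rewrite size_polyX; lia.
  by rewrite size_polyXn.
rewrite coefD coefMC coefD exprZn !coefZ coefXn coefX eqxx.
by rewrite (gtn_eqF q_gt1) !mulr0 add0r addr0 mulr1 mulrC.
Qed.

Definition surface_top x : F :=
  (eps * x (inord 0) ^+ q) ^+ (s + 2) + (eps * x (inord 1) ^+ q) ^+ (s + 2).

Lemma coef_along_ray_surface x :
  (along_ray x (affine_surface e eps))`_(q * (s + 2)) = - surface_top x.
Proof.
have [q_gt1 s_gt0] := (qe_gt1, sigma_gt0).
rewrite /affine_surface; set x0 := 'X_(inord 0); set x1 := 'X_(inord 1).
set x2 := 'X_(inord 2).
have -> : x2 ^+ q + x2 - (Gamma e eps x0 + Gamma e eps x1) =
    (x2 ^+ q + x2 - (Gamma e eps x0 - Gamma_top x0)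
      - (Gamma e eps x1 - Gamma_top x1)) - (Gamma_top x0 + Gamma_top x1) by ring.
rewrite [along_ray _ _]rmorphB coefB [X in X - _]coef_along_ray_eq0.
  rewrite sub0r rmorphD coefD.
  by rewrite -/(along_ray _ _) -/(along_ray _ _) !coef_along_ray_Gamma_top.
apply: msizeD_leq; last by rewrite msizeN msize_Gamma_low.
apply: msizeD_leq; last by rewrite msizeN msize_Gamma_low.
apply: msizeD_leq; last by apply: leq_trans (msize_var _) _; nia.
by apply: leq_trans (msize_varX _ _) _; nia.
Qed.

(** The degree is attained along the x_1-axis, where the coefficient of degree
    q (s + 2) is eps^(s+2). *)
Lemma msize_surface : msize (affine_surface e eps) = (q * (s + 2)).+1.
Proof.
have [q_gt1 s_gt0] := (qe_gt1, sigma_gt0).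
apply/eqP; rewrite eqn_leq; apply/andP; split.
  apply: msizeD_leq.
    apply: msizeD_leq; first by apply: leq_trans (msize_varX _ _) _; nia.
    by apply: leq_trans (msize_var _) _; nia.
  rewrite msizeN; apply: msizeD_leq.
    rewrite -[Gamma _ _ _](subrK (Gamma_top 'X_(inord 0))).
    by rewrite msizeD_leq ?msize_Gamma_top // leqW ?msize_Gamma_low.
  rewrite -[Gamma _ _ _](subrK (Gamma_top 'X_(inord 1))).
  by rewrite msizeD_leq ?msize_Gamma_top // leqW ?msize_Gamma_low.
rewrite ltnNge; apply/negP=> le_size.
pose x (i : 'I_3) : F := (i == 0)%:R.
have := coef_along_ray_surface x; rewrite coef_along_ray_eq0 //.
have -> : surface_top x = eps ^+ (s + 2).
  rewrite /surface_top /x -!(inj_eq val_inj) /= !inordK //=.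
  by rewrite expr1n mulr1 expr0n gtn_eqF 1?ltnW // mulr0 expr0n addn_eq0 andbF addr0.
by move/eqP; rewrite eq_sym oppr_eq0 (negPf (expf_neq0 _ eps_nz)).
Qed.

(** The function on F that [Gamma e eps] induces by evaluation. *)
Definition Gamma_val (x : F) : F :=
  (x + (x ^+ q + x) * eps) ^+ (s + 2)%N + (x ^+ q + x) ^+ s
  + (x ^+ (2 * q)%N + x ^+ 2) * eps + x ^+ (q + 1)%N + x ^+ 2.

Lemma meval_Gamma x i : (Gamma e eps 'X_i).@[x] = Gamma_val (x i).
Proof. by rewrite /Gamma !(rmorphXn, rmorphD, rmorphM) /= mevalXU mevalC. Qed.

Lemma vec4E (a b c d : F) (i : 'I_4) : vec4 a b c d 0 i = [:: a; b; c; d]`_i.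
Proof. by rewrite mxE. Qed.

Lemma surface_at_infinity (b c d : F) :
  ((homogenize (affine_surface e eps)).@[vec4 0 b c d 0] == 0) =
    (b ^+ (q * (s + 2)) + c ^+ (q * (s + 2)) == 0).
Proof.
rewrite homogenize_infinity ?vec4E // msize_surface /= coef_along_ray_surface.
rewrite oppr_eq0 /surface_top !vec4E !lift0 !inordK //=.
by rewrite !exprMn -!exprM -mulrDr mulf_eq0 (negPf (expf_neq0 _ eps_nz)).
Qed.

(** The point is given as a (1, b, c, d), so that its affine coordinates appear
    without denominators. *)
Lemma surface_affine (a b c d : F) : a != 0 ->
  ((homogenize (affine_surface e eps)).@[vec4 a (b * a) (c * a) (d * a) 0] == 0) =
    (d ^+ q + d == Gamma_val b + Gamma_val c).
Proof.
move=> a_nz; rewrite (@homogenize_affine _ _ _ _ (fun i => [:: b; c; d]`_i)).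
  rewrite vec4E /= mulf_eq0 (negPf (expf_neq0 _ a_nz)) /=.
  rewrite /affine_surface; cbv zeta; rewrite mevalB 2!mevalD rmorphXn /=.
  by rewrite !meval_Gamma !mevalXU !inordK //= subr_eq0.
by move=> i; rewrite !vec4E lift0 /=; case: i => [[|[|[|]]]].
Qed.

End SurfacePolynomial.

(** * Lines of the projective space in coordinates *)

(* Inside the scope of subspaces 0 and 1 would not be read as scalars. *)
Local Arguments vec4 {F} (a b c d)%_ring_scope.

Section LinesOfSpace.
Variable F : finFieldType.
Implicit Types (L M : {vspace 'rV[F]_4}) (u v : 'rV[F]_4).

Lemma vec4P v : exists a b c d, v = vec4 a b c d.
Proof.
exists (v 0 0), (v 0 1), (v 0 2), (v 0 3); apply/rowP => i; rewrite vec4E.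
by case: i => [[|[|[|[|]]]] //= lt_i]; congr (v 0 _); apply: val_inj.
Qed.

Lemma vec4D (a b c d a' b' c' d' : F) :
  vec4 a b c d + vec4 a' b' c' d' = vec4 (a + a') (b + b') (c + c') (d + d').
Proof. by apply/rowP => i; rewrite !mxE; case: i => [[|[|[|[|]]]]]. Qed.

Lemma vec4Z (k a b c d : F) : k *: vec4 a b c d = vec4 (k * a) (k * b) (k * c) (k * d).
Proof. by apply/rowP => i; rewrite !mxE; case: i => [[|[|[|[|]]]]]. Qed.

Lemma vec4_inj (a b c d a' b' c' d' : F) :
  vec4 a b c d = vec4 a' b' c' d' -> [/\ a = a', b = b', c = c' & d = d'].
Proof.
move=> /rowP eq_v; have := (eq_v 0, eq_v 1, eq_v 2, eq_v 3).
by rewrite !vec4E /= => [[[[-> ->] ->] ->]].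
Qed.

Lemma vec4_eq0 (a b c d : F) :
  (vec4 a b c d == 0) = [&& a == 0, b == 0, c == 0 & d == 0].
Proof.
apply/eqP/and4P => [|[/eqP-> /eqP-> /eqP-> /eqP->]].
  by rewrite -[0](scale0r (vec4 0 0 0 0)) vec4Z !mul0r => /vec4_inj[-> -> -> ->].
by apply/rowP => i; rewrite !mxE; case: i => [[|[|[|[|]]]]].
Qed.

Lemma mem_hplane (a b c d x y z t : F) :
  (vec4 x y z t \in hplane a b c d) = (a * x + b * y + c * z + d * t == 0).
Proof.
rewrite memv_ker lfunE /=; set r := _ + _.
have -> : vec4 x y z t *m (vec4 a b c d)^T = r%:M.
  apply/rowP => i; rewrite ord1 !mxE !big_ord_recr big_ord0 /= !mxE /=.
  by rewrite /r mulr1n; ring.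
apply/eqP/eqP => [/matrixP/(_ 0 0)|->]; first by rewrite !mxE.
by apply/rowP => i; rewrite !mxE mul0rn.
Qed.

Lemma mem_ell (w x y z t : F) :
  (vec4 x y z t \in ell w) = (x == 0) && (y + w * z == 0).
Proof. by rewrite memv_cap !mem_hplane !mul0r !mul1r !addr0 add0r. Qed.

(** A linear form on a space of dimension 2 has a nonzero kernel. *)
Lemma line_meets_plane L (a b c d : F) : is_line L ->
  exists2 v, v \in L & (v \in hplane a b c d) && (v != 0).
Proof.
move=> dimL; set f := linfun (mulmxr (vec4 a b c d)^T : 'rV[F]_4 -> 'rV[F]_1).
have : \dim (L :&: lker f) != 0.
  apply/eqP => dim0; have := limg_ker_dim f L; rewrite dimL dim0 add0n => dim2.
  by have := dimvS (subvf (f @: L)); rewrite dim2 dimvf.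
rewrite dimv_eq0 -vpick0 => pick_nz; have := memv_pick (L :&: lker f).
by rewrite memv_cap => /andP[pickL pickH]; exists (vpick (L :&: lker f)); rewrite ?pickH.
Qed.

Lemma line_second_vector L u : is_line L -> exists2 v, v \in L & v \notin <[u]>%VS.
Proof.
move=> dimL; apply/subvPn/negP => /dimvS; rewrite dimL dim_vline.
by case: (u != 0).
Qed.

Lemma dimv_add_vline L v : v \notin L -> \dim (L + <[v]>) = (\dim L).+1.
Proof.
move=> v_notin; have v_nz : v != 0 by apply: contraNneq v_notin => ->; exact: mem0v.
rewrite dimv_disjoint_sum ?dim_vline ?v_nz ?addn1 //; apply/eqP; rewrite -subv0.
apply/subvP => x; rewrite memv_cap => /andP[xL /vlineP[k def_x]].
have [k0|k_nz] := eqVneq k 0; first by rewrite def_x k0 scale0r mem0v.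
case/negP: v_notin; have -> : v = k^-1 *: x by rewrite def_x scalerA mulVf ?scale1r.
by rewrite memvZ.
Qed.

Lemma dim_vline2 u v : u != 0 -> v \notin <[u]>%VS -> \dim (<[u]> + <[v]>) = 2.
Proof. by move=> u_nz v_notin; rewrite dimv_add_vline // dim_vline u_nz. Qed.

Lemma line_spanned L u v : is_line L -> u \in L -> v \in L -> u != 0 ->
  v \notin <[u]>%VS -> L = (<[u]> + <[v]>)%VS.
Proof.
move=> dimL uL vL u_nz v_notin; apply/esym/eqP.
by rewrite eqEdim subv_add -!memvE uL vL dimL dim_vline2.
Qed.

Lemma mem_vline2 u v x :
  reflect (exists s t, x = s *: u + t *: v) (x \in <[u]> + <[v]>)%VS.
Proof.
apply: (iffP memv_addP) => [[_ /vlineP[s ->] [_ /vlineP[t ->] ->]]|[s [t ->]]].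
  by exists s, t.
by exists (s *: u); rewrite ?memvZ ?memv_line //; exists (t *: v); rewrite ?memvZ ?memv_line.
Qed.

Lemma contained_in_zerosP (p : {mpoly F[4]}) L :
  contained_in_zeros p L <-> forall v, v \in L -> v != 0 -> p.@[v 0] = 0.
Proof.
split=> [Lp v vL v_nz|Lp P _ PL v vP]; last exact/Lp/(subvP PL).
by apply: (Lp <[v]>%VS); rewrite ?memv_line // /is_point ?dim_vline ?v_nz // -memvE.
Qed.

Lemma mem_ell_span (w x y z t : F) : 2 \in [pchar F] ->
  (vec4 x y z t \in ell w) = (vec4 x y z t \in <[vec4 0 0 0 1]> + <[vec4 0 w 1 0]>)%VS.
Proof.
move=> char2; rewrite mem_ell.
apply/andP/mem_vline2 => [[/eqP-> yE]|[s1 [s2]]].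
  exists t, z; rewrite !vec4Z vec4D !mulr0 !mulr1 !add0r addr0 mulrC.
  by move: yE; rewrite addr_eq0 oppr_pchar2 // => /eqP->.
rewrite !vec4Z vec4D !mulr0 !mulr1 !add0r addr0 => /vec4_inj[-> -> -> _].
by rewrite mulrC addrr_pchar2.
Qed.

(** In characteristic 2 the equation X_1 + w X_2 = 0 reads X_1 = w X_2. *)
Lemma ell_span (w : F) : 2 \in [pchar F] ->
  ell w = (<[vec4 0 0 0 1]> + <[vec4 0 w 1 0]>)%VS.
Proof.
move=> char2; apply/vspaceP => v.
by have [x [y [z [t ->]]]] := vec4P v; exact: mem_ell_span.
Qed.

Lemma is_line_ell (w : F) : 2 \in [pchar F] -> is_line (ell w).
Proof.
move=> char2; rewrite /is_line ell_span // dim_vline2 //.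
  by rewrite vec4_eq0 oner_eq0 !andbF.
apply/vlineP => -[k]; rewrite vec4Z !mulr0 => /vec4_inj[_ _ /eqP].
by rewrite oner_eq0.
Qed.

End LinesOfSpace.

(** * Coordinates over F_q in F_(q^2) *)

Section QuadraticExtension.
Variables (e : nat) (F : finFieldType) (eps delta : F).
Hypotheses (e_ge3 : (3 <= e)%N) (e_odd : odd e) (cardF : #|F| = (qe e ^ 2)%N).
Hypotheses (eps_notin : ~ in_Fq e eps) (delta_in : in_Fq e delta).
Hypotheses (delta_neq1 : delta <> 1) (trace_delta : abs_trace e delta = 1).
Hypothesis eps_root : eps ^+ 2 + eps + delta = 0.
Local Notation q := (qe e).
Local Notation s := (sigma e).
Local Notation h := (2 ^ e.-1./2)%N.
Implicit Types (x y a b w : F).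

Lemma char_two : 2 \in [pchar F].
Proof.
by apply: (@card_finPcharP F 2 (e * 2)) => //; rewrite cardF /qe expnM.
Qed.

(** Reduces an identity in characteristic 2 to one that holds in every
    commutative ring, for a suitable z. *)
Lemma eq_char2 z x y : x = y + z *+ 2 -> x = y.
Proof. by rewrite mulrn_pchar ?char_two // addr0. Qed.
Local Arguments eq_char2 z {x y}.

Lemma addr_eq0_char2 x y : (x + y == 0) = (x == y).
Proof. by rewrite addr_eq0 oppr_pchar2 ?char_two. Qed.

Lemma exprD2n x y n : (x + y) ^+ (2 ^ n) = x ^+ (2 ^ n) + y ^+ (2 ^ n).
Proof. by apply: exprDn_pchar; rewrite pnatX pnatE ?char_two. Qed.

Lemma expr2n_inj n : injective (fun x => x ^+ (2 ^ n)).
Proof.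
move=> x y /eqP; rewrite -addr_eq0_char2 -exprD2n expf_eq0 => /andP[_].
by rewrite addr_eq0_char2 => /eqP.
Qed.

Lemma e_half : e = (e.-1./2).*2.+1.
Proof. by have := e_odd; lia. Qed.

Lemma sigmaE : s = (2 * h)%N.
Proof. by rewrite /sigma {1}e_half /= doubleK expnS. Qed.

(** With [sigmaE] this is 2 h^2 = q, from which the identities for
    (h + 1)-th roots of unity are derived. *)
Lemma qeE : q = (s * h)%N.
Proof. by rewrite sigmaE /qe {1}e_half expnS -addnn expnD mulnA. Qed.

Lemma h_ge2 : (1 < h)%N.
Proof.
have /leP := e_ge3; rewrite {1}e_half; case: (_./2) => [|n _]; first by lia.
by rewrite expnS; have := expn_gt0 2 n; lia.
Qed.

Lemma expr_q_q x : (x ^+ q) ^+ q = x.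
Proof. by rewrite -exprM mulnn -cardF expf_card. Qed.

Lemma in_FqD x y : in_Fq e x -> in_Fq e y -> in_Fq e (x + y).
Proof. by rewrite /in_Fq exprD2n => -> ->. Qed.

Lemma in_FqM x y : in_Fq e x -> in_Fq e y -> in_Fq e (x * y).
Proof. by rewrite /in_Fq exprMn => -> ->. Qed.

Lemma in_FqX x n : in_Fq e x -> in_Fq e (x ^+ n).
Proof. by rewrite /in_Fq exprAC => ->. Qed.

Lemma in_Fq0 : in_Fq e (0 : F).
Proof. by rewrite /in_Fq expr0n expn_eq0. Qed.

Lemma in_Fq1 : in_Fq e (1 : F).
Proof. by rewrite /in_Fq expr1n. Qed.

Lemma eps_sqr : eps ^+ 2 = eps + delta.
Proof. by apply/eqP; rewrite -addr_eq0_char2 addrA eps_root. Qed.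

(** Both eps^q and eps are roots of X^2 + X + delta, whose roots are eps and
    eps + 1, and eps^q differs from eps. *)
Lemma eps_conj : eps ^+ q = eps + 1.
Proof.
have : (eps ^+ q) ^+ 2 = eps ^+ q + delta.
  by rewrite exprAC eps_sqr exprD2n delta_in.
have : eps ^+ q != eps by apply/eqP.
set E := eps ^+ q => E_neq E_root.
have /eqP : (E + eps) * (E + eps + 1) = 0.
  by apply: (eq_char2 (E * eps + E + eps + delta)); ring: E_root eps_sqr.
by rewrite mulf_eq0 -addrA !addr_eq0_char2 (negPf E_neq) => /eqP.
Qed.

Lemma eps_nz : eps != 0.
Proof. by apply/eqP => eps0; apply: eps_notin; rewrite eps0; exact: in_Fq0. Qed.

(** The coordinates of x are b = x^q + x and a = x + b eps. *)
Lemma coordP x : exists a b, [/\ in_Fq e a, in_Fq e b & x = a + b * eps].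
Proof.
have b_in : in_Fq e (x ^+ q + x) by rewrite /in_Fq exprD2n expr_q_q addrC.
exists (x + (x ^+ q + x) * eps), (x ^+ q + x); split=> //.
  rewrite /in_Fq exprD2n exprMn b_in eps_conj.
  by apply: (eq_char2 (x ^+ q)); ring.
by apply: (eq_char2 (- (x ^+ q + x) * eps)); ring.
Qed.

Lemma trace_coord a b : in_Fq e a -> in_Fq e b ->
  (a + b * eps) ^+ q + (a + b * eps) = b.
Proof.
move=> a_in b_in; rewrite exprD2n exprMn a_in b_in eps_conj.
by apply: (eq_char2 (a + b * eps)); ring.
Qed.

Lemma coord_inj a b a' b' : in_Fq e a -> in_Fq e b -> in_Fq e a' -> in_Fq e b' ->
  a + b * eps = a' + b' * eps -> a = a' /\ b = b'.
Proof.
move=> a_in b_in a'_in b'_in eq_x; have bb' : b = b'.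
  by rewrite -(trace_coord a_in b_in) eq_x trace_coord.
by split=> //; move: eq_x; rewrite bb' => /addIr.
Qed.

(** The argument of the power s + 2 is a itself, and the terms
    b^2 eps, x^(q+1) and x^2 add up to a b. *)
Lemma Gamma_coord a b : in_Fq e a -> in_Fq e b ->
  Gamma_val e eps (a + b * eps) = a ^+ (s + 2) + a * b + b ^+ s.
Proof.
move=> a_in b_in; have tr := trace_coord a_in b_in.
have conj : (a + b * eps) ^+ q = b + (a + b * eps).
  by rewrite -{2}tr -addrA addrr_pchar2 ?char_two ?addr0.
rewrite /Gamma_val tr.
have -> : a + b * eps + b * eps = a by apply: (eq_char2 (b * eps)); ring.
have -> : (a + b * eps) ^+ (2 * q) = (b + (a + b * eps)) ^+ 2.
  by rewrite mulnC exprM conj.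
rewrite [_ ^+ (q + 1)]exprD expr1 conj.
set u := a ^+ _; set v := b ^+ _.
apply: (eq_char2 ((a + b * eps) * (b + (a + b * eps)) * eps
                   + (a + b * eps) ^+ 2 + b ^+ 2 * eps)).
by ring.
Qed.

(** As (a, b) |-> a + b eps is a bijection from F_q x F_q to F, the square of
    the number of fixed points of x |-> x^q is q^2. *)
Lemma card_Fq : #|[set x : F | x ^+ q == x]| = q.
Proof.
set A := [set x | _].
apply/eqP; rewrite -(@eqn_exp2r _ _ 2) // -cardF -mulnn -cardsX -cardsT.
rewrite -(@card_in_imset _ _ (fun z : F * F => z.1 + z.2 * eps)); last first.
  move=> [a b] [a' b']; rewrite !inE /=.
  move=> /andP[/eqP a_in /eqP b_in] /andP[/eqP a'_in /eqP b'_in].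
  by case/coord_inj=> // -> ->.
apply/eqP; congr #|pred_of_set _|; apply/setP => x; rewrite inE; apply/imsetP.
have [a [b [a_in b_in ->]]] := coordP x.
by exists (a, b); rewrite ?inE /= ?a_in ?b_in ?eqxx.
Qed.

(** A polynomial with q roots and degree s + 2 < q is zero, and the exponents
    s + 2, s, 2, 1 and 0 are distinct because s >= 4. *)
Lemma vanishing_on_Fq (A B C D E : F) :
    (forall a, in_Fq e a ->
       A * a ^+ (s + 2) + B * a ^+ s + C * a ^+ 2 + D * a + E = 0) ->
  [/\ A = 0, B = 0, C = 0, D = 0 & E = 0].
Proof.
move=> vanish; have [h_gt1 s_eq q_eq] := And3 h_ge2 sigmaE qeE.
pose p : {poly F} := A *: 'X^(s + 2) + B *: 'X^s + C *: 'X^2 + D *: 'X + E%:P.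
have size_p : (size p <= q)%N.
  have le_q : (s + 3 <= q)%N.
    by rewrite q_eq s_eq; move: h_gt1; move: h => H; nia.
  apply: leq_trans le_q; rewrite /p.
  do 4?[apply: leq_trans (size_polyD _ _) _; rewrite geq_max; apply/andP; split];
    rewrite ?(leq_trans (size_scale_leq _ _)) ?size_polyXn ?size_polyX ?size_polyC //; try lia.
have p0 : p = 0.
  apply: contraTeq size_p => p_nz; rewrite -ltnNge -card_Fq cardE.
  apply: max_poly_roots; rewrite ?enum_uniq //; apply/allP => a.
  rewrite mem_enum inE => /eqP a_in.
  by rewrite rootE !(hornerD, hornerZ, hornerXn, hornerX, hornerC) vanish.
have coef_p i : p`_i = 0 by rewrite p0 coef0.
move: (coef_p (s + 2)%N) (coef_p s) (coef_p 2) (coef_p 1) (coef_p 0).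
rewrite /p !(coefD, coefZ, coefXn, coefX, coefC).
have [n ->] : exists n, s = n.+3 by exists (s - 3)%N; lia.
have [lt_n gt_n] : (n.+2 == n) = false /\ (n == n.+2) = false by split; lia.
have -> : (n.+3 + 2 = n.+1.+4)%N by lia.
rewrite !eqSS lt_n gt_n eqxx /= !(mulr0, mulr1, addr0, add0r).
by move=> -> -> -> -> ->.
Qed.

(** * The roots of unity of exponent h + 1 *)

(** From w^h = w^-1 follows w^(h^2) = w, and q = 2 h^2. *)
Lemma unity_expr_q w : w ^+ (h + 1) = 1 -> w ^+ q = w ^+ 2.
Proof.
rewrite exprD expr1 => wh.
have wh2 : w ^+ (h * h) = w.
  have w_nz : w ^+ h != 0.
    by apply: contra_eq_neq wh => ->; rewrite mul0r eq_sym oner_eq0.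
  by apply: (mulIf w_nz); rewrite exprM -exprMn wh expr1n mulrC.
have -> : q = (h * h * 2)%N by rewrite qeE sigmaE -mulnA mulnC.
by rewrite exprM wh2.
Qed.

(** Applying [unity_expr_q] twice gives w = w^(q^2) = w^4. *)
Lemma unity_cubed w : w ^+ (h + 1) = 1 -> w ^+ 3 = 1.
Proof.
move=> w_root; have w_q := unity_expr_q w_root.
have w_nz : w != 0.
  by apply: contra_eq_neq w_root => ->; rewrite expr0n addn1 eq_sym oner_eq0.
apply: (mulIf w_nz); rewrite -exprSr mul1r.
by rewrite -[RHS]expr_q_q w_q exprAC w_q -exprM.
Qed.

Lemma unity_Fq w : in_Fq e w -> w ^+ (h + 1) = 1 -> w = 1.
Proof.
move=> w_in w_root; have w_sqr : w = w ^+ 2 by rewrite -unity_expr_q.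
by have := unity_cubed w_root; rewrite exprS -w_sqr -expr2 -w_sqr.
Qed.

Lemma cube_root_expr4n w j : w ^+ 3 = 1 -> w ^+ (4 ^ j) = w.
Proof.
move=> w3; elim: j => [|j IHj]; first by rewrite expn0.
by rewrite expnS mulnC exprM IHj exprSr w3 mul1r.
Qed.

Lemma h_mod1 : (e %% 4 = 1)%N -> h = (4 ^ (e %/ 4))%N.
Proof.
move=> e1; rewrite {1}(divn_eq e 4) e1 addn1 /= -(mulnC 4) -(@expnM 2 2).
by congr (2 ^ _)%N; lia.
Qed.

Lemma h_mod3 : (e %% 4 = 3)%N -> h = (4 ^ (e %/ 4) * 2)%N.
Proof.
move=> e3; rewrite {1}(divn_eq e 4) e3 -(@expnM 2 2) -expnSr.
by congr (2 ^ _)%N; lia.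
Qed.

Lemma unity_mod1 w : (e %% 4 = 1)%N -> w ^+ (h + 1) = 1 -> w = 1.
Proof.
move=> e1 w_root; have w3 := unity_cubed w_root.
move: w_root; rewrite h_mod1 // exprD cube_root_expr4n // expr1 => w2.
by rewrite -w3 exprS expr2 w2 mulr1.
Qed.

Lemma unity_mod3 w : (e %% 4 = 3)%N -> (w ^+ (h + 1) = 1 <-> w ^+ 3 = 1).
Proof.
move=> e3; split=> [|w3]; first exact: unity_cubed.
by rewrite h_mod3 // exprD exprM cube_root_expr4n // -exprD.
Qed.

(** For odd e and x in F_q, a solution of X^2 + X = x + Tr x: with
    n = (e + 1) / 2 summands the square fills in the odd powers of the
    Frobenius map. *)
Definition half_trace n x : F := \sum_(i < n) x ^+ (2 ^ i.*2).

Lemma half_trace_sqr n x :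
  half_trace n x ^+ 2 + half_trace n x = \sum_(i < n.*2) x ^+ (2 ^ i).
Proof.
elim: n => [|n IHn]; first by rewrite /half_trace !big_ord0 expr0n addr0.
rewrite doubleS !big_ord_recr /= -IHn /half_trace big_ord_recr /=.
by rewrite (exprD2n _ _ 1) -exprM -expnSr; ring.
Qed.

(** The sum over i <= e in [half_trace_sqr] is the trace of delta, which is 1,
    plus delta^q, which is delta. *)
Lemma cube_root_coord : exists2 w0, in_Fq e w0 & w0 ^+ 2 + w0 = 1 + delta.
Proof.
exists (half_trace (e.-1./2).+1 delta).
  rewrite /in_Fq /half_trace; elim/big_rec: _ => [|i x _ x_in].
    exact: in_Fq0.
  by rewrite exprD2n exprAC delta_in x_in.
rewrite half_trace_sqr doubleS -e_half big_ord_recr /=.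
by rewrite -/(abs_trace e delta) trace_delta delta_in.
Qed.

(** The conditions on w0 and on eps add up to w^2 + w = 1 for w = w0 + eps. *)
Lemma primitive_cube_root : exists w : F, w ^+ 2 + w + 1 = 0.
Proof.
have [w0 _ w0_eq] := cube_root_coord; exists (w0 + eps).
rewrite (exprD2n _ _ 1) /= expn1 eps_sqr.
have -> : w0 ^+ 2 = 1 + delta - w0 by rewrite -w0_eq; ring.
by apply: (eq_char2 (1 + delta + eps)); ring.
Qed.

Lemma cube_root_neq1 w x : w ^+ 2 + w + 1 = 0 ->
  (x ^+ 3 = 1 /\ x <> 1) <-> (x = w \/ x = w + 1).
Proof.
move=> w_root; have fact y : y ^+ 3 - 1 = (y - 1) * (y ^+ 2 + y + 1) by ring.
have split_x : x ^+ 2 + x + 1 = (x + w) * (x + (w + 1)).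
  have w2 : w ^+ 2 = - w - 1 by apply/eqP; rewrite -subr_eq0 -w_root; apply/eqP; ring.
  by apply: (eq_char2 (- x * w + 1)); ring: w2.
split=> [[x3 x1]|x_w].
  have /eqP : (x - 1) * (x ^+ 2 + x + 1) = 0 by rewrite -fact x3 subrr.
  rewrite mulf_eq0 subr_eq0 split_x mulf_eq0 !addr_eq0_char2.
  by case/or3P=> /eqP; [|left|right].
have x_root : x ^+ 2 + x + 1 = 0.
  by apply/eqP; rewrite split_x mulf_eq0 !addr_eq0_char2; case: x_w => ->; rewrite eqxx ?orbT.
split; first by apply/eqP; rewrite -subr_eq0 fact x_root mulr0.
move=> x1; move: x_root; rewrite x1 expr1n => /eqP.
by rewrite addrr_pchar2 ?char_two // add0r oner_eq0.
Qed.

(** * Affine lines on the surface *)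

Ltac solve_in_Fq :=
  repeat first [ assumption | exact: in_Fq0 | exact: in_Fq1
               | apply: in_FqD | apply: in_FqM | apply: in_FqX ].

Lemma Gamma_Fq a : in_Fq e a -> Gamma_val e eps a = a ^+ (s + 2).
Proof.
move=> a_in; rewrite -[X in Gamma_val _ _ X]addr0 -(mul0r eps).
rewrite Gamma_coord; try by solve_in_Fq.
by rewrite mulr0 addr0 expr0n expn_eq0 addr0.
Qed.

Lemma exprs2D a b : (a + b) ^+ (s + 2) = (a ^+ s + b ^+ s) * (a ^+ 2 + b ^+ 2).
Proof. by rewrite exprD exprD2n (exprD2n _ _ 1). Qed.

(** Let c = c0 + c1 eps, v = v0 + v1 eps and d = d0 + d1 eps. On t = a in F_q the
    condition is a polynomial identity in a: the coefficient of a^s gives c0 = 0, the linear one v1 = c1, the constant one d1 = c1^s. The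
    single value t = eps then gives v0 = v1. *)
Lemma secant_direction1 (c v d : F) :
    (forall t, (v * t + d) ^+ q + (v * t + d) =
               Gamma_val e eps (t + c) + Gamma_val e eps t) ->
  exists2 al, in_Fq e al &
    [/\ c = al * eps, v = eps ^+ q * al &
      exists2 d0, in_Fq e d0 & d = d0 + al ^+ s * eps].
Proof.
have [c0 [c1 [c0_in c1_in ->]]] := coordP c.
have [v0 [v1 [v0_in v1_in ->]]] := coordP v.
have [d0 [d1 [d0_in d1_in ->]]] := coordP d.
move=> on_surface.
have [_ /eqP c0_sqr _ /eqP] : [/\ 0 = 0 :> F, c0 ^+ 2 = 0, c0 ^+ s = 0, c1 + v1 = 0 &
    c0 ^+ (s + 2) + c0 * c1 + c1 ^+ s + d1 = 0].
  apply: vanishing_on_Fq => a a_in; have := on_surface a.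
  have -> : (v0 + v1 * eps) * a + (d0 + d1 * eps) =
      (v0 * a + d0) + (v1 * a + d1) * eps by ring.
  have -> : a + (c0 + c1 * eps) = (a + c0) + c1 * eps by ring.
  rewrite trace_coord ?Gamma_coord ?Gamma_Fq; try by solve_in_Fq.
  rewrite exprs2D !exprD; move: (a ^+ s) (c0 ^+ s) (c1 ^+ s) => as_ c0s c1s eq_a.
  have -> : d1 = v1 * a + d1 - v1 * a by ring.
  apply: (eq_char2 (as_ * a ^+ 2 + as_ * c0 ^+ 2 + c0s * a ^+ 2 + c0s * c0 ^+ 2
                    + (a + c0) * c1 + c1s)).
  by rewrite eq_a; ring.
move: c0_sqr; rewrite expf_eq0 /= => /eqP c00.
rewrite addr_eq0_char2 => /eqP def_v1; rewrite -def_v1 c00 in on_surface v1_in *.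
rewrite !expr0n addn2 mul0r !add0r => /eqP; rewrite addr_eq0_char2 => /eqP def_d1.
have := on_surface eps.
have -> : (v0 + c1 * eps) * eps + (d0 + d1 * eps) =
    (c1 * delta + d0) + (v0 + c1 + d1) * eps by ring: eps_sqr.
have -> : eps + (0 + c1 * eps) = 0 + (c1 + 1) * eps by ring.
have -> : Gamma_val e eps eps = Gamma_val e eps (0 + 1 * eps) by rewrite mul1r add0r.
rewrite trace_coord ?Gamma_coord; try by solve_in_Fq.
rewrite !expr0n addn2 exprD2n expr1n -def_d1 !(mul0r, add0r, addr0) /= => eq_v.
have /eqP : v0 + c1 = 0.
  apply: (addIr (c1 ^+ s)); rewrite add0r [LHS]eq_v -addrA.
  by rewrite addrr_pchar2 ?char_two ?addr0.
rewrite addr_eq0_char2 => /eqP ->.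
(* Now d1 = c1^s and v0 = v1 = c1, so al = c1. *)
exists c1 => //; split=> //.
  by rewrite eps_conj; ring.
by exists d0; rewrite // def_d1.
Qed.

Lemma secant_on_surface1 al d0 t : in_Fq e al -> in_Fq e d0 ->
  let x3 := eps ^+ q * al * t + (d0 + al ^+ s * eps) in
  x3 ^+ q + x3 = Gamma_val e eps (t + al * eps) + Gamma_val e eps t.
Proof.
move=> al_in d0_in; have [a [b [a_in b_in ->]]] := coordP t => x3.
have -> : x3 = (al * a + al * b * delta + d0) + (al * a + al ^+ s) * eps.
  rewrite /x3 eps_conj; apply: (eq_char2 (al * b * eps)); ring: eps_sqr.
have -> : a + b * eps + al * eps = a + (b + al) * eps by ring.
rewrite trace_coord ?Gamma_coord; try by solve_in_Fq.
rewrite exprD2n; move: (a ^+ _) (b ^+ _) (al ^+ _) => u v w.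
by apply: (eq_char2 (- (u + a * b + v))); ring.
Qed.

(** Here w is a primitive cube root of unity with w^q = w^2 = w + 1, so
    w0 = w + eps lies in F_q. For t = a in F_q and c = c0 + c1 eps the first
    coordinate of w t + c is w0 a + c0, and the coefficient of a^(s+2) is w0^(s+2) + 1. As
    w0^(h+1) = 1 forces w0 = 1 in F_q, the sum w^2 + w + 1 is delta + 1, which is
    not 0. *)
Lemma secant_direction_neq1 w (c v d : F) : w ^+ (h + 1) = 1 -> w <> 1 ->
  ~ forall t, (v * t + d) ^+ q + (v * t + d) =
              Gamma_val e eps (w * t + c) + Gamma_val e eps t.
Proof.
move=> w_root w1 on_surface; have w3 := unity_cubed w_root.
have w_eq : w ^+ 2 = w + 1.
  have /eqP : (w - 1) * (w ^+ 2 + w + 1) = 0.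
    by apply/eqP; rewrite -(subrr (w ^+ 3)) {2}w3; apply/eqP; ring.
  rewrite mulf_eq0 subr_eq0 => /orP[/eqP // | ].
  by rewrite -addrA addr_eq0_char2 => /eqP.
have [w0 def_w0] : exists w0, w0 = w + eps by exists (w + eps).
have w0_in : in_Fq e w0.
  rewrite /in_Fq def_w0 exprD2n eps_conj (unity_expr_q w_root) w_eq.
  by apply: (eq_char2 1); ring.
have def_w : w = w0 + 1 * eps by apply: (eq_char2 (- eps)); rewrite def_w0; ring.
have [c0 [c1 [c0_in c1_in def_c]]] := coordP c.
have [v0 [v1 [v0_in v1_in def_v]]] := coordP v.
have [d0 [d1 [d0_in d1_in def_d]]] := coordP d.
have [/eqP w0_root _ _ _ _] : [/\ w0 ^+ (s + 2) + 1 = 0,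
    w0 ^+ s * c0 ^+ 2 + 1 = 0, c0 ^+ s * w0 ^+ 2 + w0 = 0,
    w0 * c1 + c0 + v1 = 0 & c0 ^+ (s + 2) + c0 * c1 + c1 ^+ s + d1 = 0].
  apply: vanishing_on_Fq => a a_in; have := on_surface a; rewrite def_v def_d def_c.
  have -> : (v0 + v1 * eps) * a + (d0 + d1 * eps) =
      (v0 * a + d0) + (v1 * a + d1) * eps by ring.
  have -> : w * a + (c0 + c1 * eps) = (w0 * a + c0) + (a + c1) * eps.
    by rewrite {1}def_w; ring.
  rewrite trace_coord ?Gamma_coord ?Gamma_Fq; try by solve_in_Fq.
  rewrite exprs2D !exprD2n !exprMn !exprD.
  move: (a ^+ s) (c0 ^+ s) (c1 ^+ s) (w0 ^+ s) => as_ c0s c1s w0s eq_a.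
  have -> : d1 = v1 * a + d1 - v1 * a by ring.
  rewrite eq_a.
  apply: (eq_char2 (w0s * as_ * w0 ^+ 2 * a ^+ 2 + w0s * as_ * c0 ^+ 2
     + c0s * w0 ^+ 2 * a ^+ 2 + c0s * c0 ^+ 2 + (w0 * a + c0) * (a + c1)
     + as_ + c1s + as_ * a ^+ 2)); ring.
have w01 : w0 = 1.
  apply: unity_Fq => //; apply: (@expr2n_inj 1); rewrite /= expn1 expr1n.
  move: w0_root; rewrite addr_eq0_char2 sigmaE -[X in (_ + X)%N]muln1 -mulnDr.
  by rewrite mulnC exprM => /eqP.
apply: delta_neq1; have : w ^+ 2 = w + 1 by [].
rewrite def_w w01 mul1r (exprD2n _ _ 1) /= expn1 expr1n eps_sqr => eq_d.
apply: (@addrI _ (1 + eps)).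
by rewrite -addrA eq_d.
Qed.

(** * Lines contained in the surface *)

Local Notation V := (line_in_V e eps).
Local Notation surface := (homogenize (affine_surface e eps)).
Implicit Types (L : {vspace 'rV[F]_4}).

Let e_gt0 : (0 < e)%N.
Proof. exact: leq_trans e_ge3. Qed.

(** The exponent q (s + 2) is (h + 1) 2^(e+1), and raising to a power of 2 is
    injective. *)
Lemma surface_at_infinity_unity b c d :
  (surface.@[vec4 0 b c d 0] == 0) = (b ^+ (h + 1) == c ^+ (h + 1)).
Proof.
rewrite (surface_at_infinity e_gt0 eps_nz).
have -> : (q * (s + 2) = (h + 1) * 2 ^ e.+1)%N.
  by rewrite sigmaE expnS /qe mulnC; ring.
rewrite !exprM addr_eq0_char2; exact: (inj_eq (@expr2n_inj e.+1)).
Qed.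

Lemma line_in_V_ell w : w ^+ (h + 1) = 1 -> V (ell w).
Proof.
move=> w_root; split; first by apply: is_line_ell; exact: char_two.
apply/contained_in_zerosP => v; have [x [y [z [t ->]]]] := vec4P v.
rewrite mem_ell addr_eq0_char2 => /andP[/eqP-> /eqP->] _.
by apply/eqP; rewrite surface_at_infinity_unity exprMn w_root mul1r.
Qed.

Lemma zero_on_surface L v : V L -> v \in L -> surface.@[v 0] = 0.
Proof.
move=> [_ /contained_in_zerosP onL] vL.
have [->|] := eqVneq v 0; last exact: onL.
have -> : 0 = vec4 0 0 0 0 :> 'rV[F]_4 by apply/esym/eqP; rewrite vec4_eq0 !eqxx.
by apply/eqP; rewrite surface_at_infinity_unity.
Qed.

(** The intersection with X_2 = 0 is a point where X_1 vanishes as well, that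
    is P_infty. A second point of the line has X_2 <> 0 and determines w. *)
Lemma line_at_infinity L : V L -> (L <= hplane 1%R 0%R 0%R 0%R)%VS ->
  exists2 w, w ^+ (h + 1) = 1 & L = ell w.
Proof.
move=> V_L L_inf; have dimL := V_L.1.
have hn0 y : 0 ^+ (h + 1) = y ^+ (h + 1) -> y = 0.
  by rewrite expr0n addn1 /= => /esym/eqP; rewrite expf_eq0 => /eqP.
have in_L x y z t : vec4 x y z t \in L -> x = 0 /\ y ^+ (h + 1) = z ^+ (h + 1).
  move=> vL; have := subvP L_inf _ vL; rewrite mem_hplane !mul0r !addr0 mul1r => /eqP x0.
  rewrite x0 in vL *; split=> //.
  by apply/eqP; rewrite -(surface_at_infinity_unity y z t) (zero_on_surface V_L).
have [u] := line_meets_plane 0 0 1 0 dimL; have [x [y [z [t ->]]]] := vec4P u.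
rewrite mem_hplane !mul0r !add0r addr0 mul1r => uL /andP[/eqP z0].
rewrite z0 in uL *; have [x0 /esym/hn0 y0] := in_L _ _ _ _ uL.
rewrite x0 y0 in uL *; rewrite vec4_eq0 !eqxx /= => t_nz.
have [v vL v_notin] := line_second_vector (vec4 0 0 0 t) dimL.
have [x' [y' [z' [t' def_v]]]] := vec4P v; rewrite def_v in vL v_notin *.
have [x'0 y'z'] := in_L _ _ _ _ vL; rewrite x'0 in vL v_notin *.
have z'_nz : z' != 0.
  apply: contraNneq v_notin => z'0; rewrite z'0 in y'z' *.
  rewrite (hn0 _ (esym y'z')); apply/vlineP; exists (t' / t).
  by rewrite vec4Z !mulr0 divfK.
exists (y' / z'); first by rewrite expr_div_n y'z' divff // expf_neq0.
apply/eqP; rewrite eqEdim (is_line_ell _ char_two) dimL leqnn andbT.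
rewrite (line_spanned dimL uL vL) //; last by rewrite vec4_eq0 !eqxx.
by rewrite subv_add -!memvE !mem_ell mulr0 addr0 divfK // addr_eq0_char2 !eqxx.
Qed.

(** The affine line t |-> (t + al eps, t, eps^q al t + d0 + al^s eps), spanned by
    its point at infinity and its point with t = 0. *)
Definition secant al d0 : {vspace 'rV[F]_4} :=
  (L_infty e eps al + <[vec4 1 (al * eps) 0 (d0 + al ^+ s * eps)]>)%VS.

Lemma L_infty_neq0 al : vec4 0 1 1 (eps ^+ q * al) != 0.
Proof. by rewrite vec4_eq0 oner_eq0 andbF. Qed.

Lemma mem_secant al d0 (v : 'rV[F]_4) : reflect
  (exists s1 t, v = vec4 t (s1 + t * (al * eps)) s1
                      (s1 * (eps ^+ q * al) + t * (d0 + al ^+ s * eps)))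
  (v \in secant al d0).
Proof.
apply: (iffP (mem_vline2 _ _ _)) => -[s1 [t ->]]; exists s1, t;
  by rewrite !vec4Z vec4D !mulr0 !mulr1 addr0 add0r.
Qed.

Lemma line_in_V_secant al d0 : in_Fq e al -> in_Fq e d0 -> V (secant al d0).
Proof.
move=> al_in d0_in; split.
  rewrite /is_line dim_vline2 ?L_infty_neq0 //; apply/vlineP => -[k].
  by rewrite vec4Z mulr0 => /vec4_inj[/eqP]; rewrite oner_eq0.
apply/contained_in_zerosP => _ /mem_secant[s1 [t ->]] _; apply/eqP.
have [->|t_nz] := eqVneq t 0.
  by rewrite !mul0r addr0 surface_at_infinity_unity.
have -> : vec4 t (s1 + t * (al * eps)) s1
    (s1 * (eps ^+ q * al) + t * (d0 + al ^+ s * eps)) =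
  vec4 t ((s1 / t + al * eps) * t) (s1 / t * t)
    ((eps ^+ q * al * (s1 / t) + (d0 + al ^+ s * eps)) * t).
  by move: (al ^+ s) (eps ^+ q) => u v; congr (vec4 _ _ _ _); field.
rewrite surface_affine //.
by apply/eqP; exact: secant_on_surface1.
Qed.

(** The point at infinity of the line has X_2 <> 0: otherwise it is P_infty, and
    x_3 would take all values while its trace is fixed by the constants x_1
    and x_2. So the line has the
    parametrization required by [secant_direction1] and
    [secant_direction_neq1]. *)
Lemma affine_line L : V L -> ~~ (L <= hplane 1%R 0%R 0%R 0%R)%VS ->
  exists al d0, [/\ in_Fq e al, in_Fq e d0 & L = secant al d0].
Proof.
move=> V_L /subvPn[u uL]; have dimL := V_L.1.
have [x [y [z [t def_u]]]] := vec4P u; rewrite def_u in uL *.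
rewrite mem_hplane !mul0r !addr0 mul1r => x_nz.
have {u def_u uL} [y0 [z0 [t0 uL]]] : exists y0 z0 t0, vec4 1 y0 z0 t0 \in L.
  by exists (x^-1 * y), (x^-1 * z), (x^-1 * t); rewrite -(mulVf x_nz) -vec4Z memvZ.
have [v vL] := line_meets_plane 1 0 0 0 dimL.
have [x1 [b [c [d def_v]]]] := vec4P v; rewrite def_v in vL *.
rewrite mem_hplane !mul0r !addr0 mul1r => /andP[/eqP x10]; rewrite x10 in vL *.
rewrite vec4_eq0 eqxx /= => v_nz.
have on_line b' c' d' y' z' t' k : vec4 1 y' z' t' \in L -> vec4 0 b' c' d' \in L ->
    (t' + k * d') ^+ q + (t' + k * d') =
      Gamma_val e eps (y' + k * b') + Gamma_val e eps (z' + k * c').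
  move=> u'L v'L; apply/eqP; rewrite -(@surface_affine _ _ _ 1) ?oner_eq0 //.
  apply/eqP/(zero_on_surface V_L); rewrite !mulr1.
  have := memvD u'L (memvZ k v'L).
  by rewrite vec4Z vec4D mulr0 addr0.
have bc : b ^+ (h + 1) = c ^+ (h + 1).
  by apply/eqP; rewrite -(surface_at_infinity_unity b c d) (zero_on_surface V_L).
have c_nz : c != 0.
  apply/eqP => c0; have b0 : b = 0.
    by apply/eqP; move/eqP: bc; rewrite c0 expr0n addn1 /= expf_eq0 => /eqP->.
  rewrite b0 c0 !eqxx /= in v_nz vL.
  (* The parameter eps / d moves x_3 by eps, whose trace is 1. *)
  have := on_line _ _ _ _ _ _ (eps / d) uL vL; have := on_line _ _ _ _ _ _ 0 uL vL.
  rewrite !mul0r !mulr0 !addr0 divfK // => <- /eqP.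
  rewrite exprD2n eps_conj -subr_eq0 => /eqP tr_eps.
  have /eqP : 1 = 0 :> F by apply: (eq_char2 (- eps)); rewrite -tr_eps; ring.
  by rewrite oner_eq0.
have {v_nz} [w [v3 [w_root v'L]]] : exists w v3,
    w ^+ (h + 1) = 1 /\ vec4 0 w 1 v3 \in L.
  exists (b / c), (d / c); split; first by rewrite expr_div_n bc divff ?expf_neq0.
  by rewrite -(mulr0 c^-1) -[X in vec4 _ _ X _](mulVf c_nz) ![_ / c]mulrC -vec4Z memvZ.
have [c' [d' u'L]] : exists c' d', vec4 1 c' 0 d' \in L.
  exists (y0 - z0 * w), (t0 - z0 * v3); have := memvB uL (memvZ z0 v'L).
  by rewrite vec4Z -scaleN1r vec4Z vec4D !(mulr0, mulr1, mulN1r, subr0, subrr).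
have on_surface k : (v3 * k + d') ^+ q + (v3 * k + d') =
    Gamma_val e eps (w * k + c') + Gamma_val e eps k.
  have := on_line _ _ _ _ _ _ k u'L v'L.
  by rewrite mulr1 add0r ![_ + k * _]addrC ![k * _]mulrC.
have w1 : w = 1.
  by apply/eqP/negPn/negP => /eqP w_neq1; apply: secant_direction_neq1 on_surface.
rewrite w1 in v'L on_surface.
have [|al al_in [def_c def_v3 [d0 d0_in def_d]]] := @secant_direction1 c' v3 d'.
  by move=> k; rewrite on_surface mul1r.
exists al, d0; split=> //; rewrite def_c def_v3 def_d in u'L v'L.
apply: line_spanned => //; first exact: L_infty_neq0.
apply/vlineP => -[k].
by rewrite vec4Z mulr0 => /vec4_inj[/eqP]; rewrite oner_eq0.
Qed.

Lemma line_in_V_cases L : V L ->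
  (exists2 w, w ^+ (h + 1) = 1 & L = ell w) \/
  (exists al d0, [/\ in_Fq e al, in_Fq e d0 & L = secant al d0]).
Proof.
move=> V_L; case: (boolP (L <= hplane 1%R 0%R 0%R 0%R)%VS) => L_inf.
  by left; exact: line_at_infinity.
by right; exact: affine_line.
Qed.

(** * The Hermitian cone of lines through a point L_infty *)

Lemma vlineZ k (v : 'rV[F]_4) : k != 0 -> <[k *: v]>%VS = <[v]>%VS.
Proof.
move=> k_nz; apply/eqP; rewrite eqEsubv -!memvE memvZ ?memv_line //=.
by apply/vlineP; exists k^-1; rewrite scalerA mulVf ?scale1r.
Qed.

Definition cone_frame al : 2.-tuple 'rV[F]_4 :=
  [tuple vec4 1 (al * eps) 0 (al ^+ s * eps); vec4 0 0 0 1].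

Definition cone_line al : {vspace 'rV[F]_4} := <<cone_frame al>>%VS.

(** The Baer subline in which the lines of the cone meet [cone_line al]; in the
    frame it consists of the points with coordinates (0, 1) and (1, d0), d0 in
    F_q. *)
Definition cone_base al (P : {vspace 'rV[F]_4}) : Prop :=
  P = P_infty F \/
  exists2 d0, in_Fq e d0 & P = <[vec4 1 (al * eps) 0 (d0 + al ^+ s * eps)]>%VS.

Definition cone_lines al : seq {vspace 'rV[F]_4} :=
  ell 1 :: [seq secant al d0 | d0 <- enum [set x : F | x ^+ q == x]].

Lemma secant_eq al d0 al' d0' : secant al d0 = secant al' d0' -> al = al' /\ d0 = d0'.
Proof.
move=> eq_sec.
have epsq_nz : eps ^+ q != 0 by rewrite expf_neq0 ?eps_nz.
have : vec4 0 1 1 (eps ^+ q * al) \in secant al' d0'.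
  rewrite -eq_sec; apply/mem_secant; exists 1, 0.
  by rewrite !mul0r !mul1r !addr0.
move=> /mem_secant[s1 [t /vec4_inj[<- _ <-]]].
rewrite mul0r mul1r addr0 => /(mulfI epsq_nz) eq_al; rewrite -eq_al in eq_sec *.
split=> //; have : vec4 1 (al * eps) 0 (d0 + al ^+ s * eps) \in secant al d0'.
  rewrite -eq_sec; apply/mem_secant; exists 0, 1.
  by rewrite !mul0r !mul1r !add0r.
move=> /mem_secant[s2 [t2 /vec4_inj[<- _ <-]]].
by rewrite mul0r mul1r add0r => /addIr.
Qed.

Lemma ell1_neq_secant al d0 : ell 1 <> secant al d0.
Proof.
move=> eq_L; have : vec4 1 (al * eps) 0 (d0 + al ^+ s * eps) \in ell (1 : F).
  by rewrite eq_L; apply/mem_secant; exists 0, 1; rewrite !mul0r !mul1r !add0r.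
by rewrite mem_ell oner_eq0.
Qed.

Lemma mem_cone_lines al L :
  L \in cone_lines al <-> L = ell 1 \/ exists2 d0, in_Fq e d0 & L = secant al d0.
Proof.
rewrite inE; split=> [/orP[/eqP->|/mapP[d0]]|[->|[d0 d0_in ->]]].
- by left.
- by rewrite mem_enum inE => /eqP d0_in ->; right; exists d0.
- by rewrite eqxx.
by apply/orP; right; apply: map_f; rewrite mem_enum inE; apply/eqP.
Qed.

Lemma uniq_cone_lines al : uniq (cone_lines al).
Proof.
rewrite /= map_inj_uniq ?enum_uniq ?andbT; last by move=> d d' /secant_eq[].
by apply/mapP => -[d0 _] /ell1_neq_secant.
Qed.

Lemma size_cone_lines al : size (cone_lines al) = q.+1.
Proof. by rewrite /= size_map -cardE card_Fq. Qed.

Lemma L_infty_sub_ell w al : (L_infty e eps al <= ell w)%VS -> w = 1.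
Proof. by rewrite -memvE mem_ell mulr1 eqxx addr_eq0_char2 => /eqP. Qed.

Lemma line_in_V_through_L_infty al L : in_Fq e al ->
  L \in cone_lines al <-> V L /\ (L_infty e eps al <= L)%VS.
Proof.
move=> al_in; rewrite mem_cone_lines; split=> [[->|[d0 d0_in ->]]|[V_L]].
- split; first by apply: line_in_V_ell; rewrite expr1n.
  by rewrite -memvE mem_ell eqxx mul1r addrr_pchar2 ?char_two ?eqxx.
- by split; [exact: line_in_V_secant|rewrite addvSl].
case: (line_in_V_cases V_L) => [[w _ ->] /L_infty_sub_ell ->|[al' [d0 [_ d0_in ->]]]].
  by left.
rewrite -memvE => /mem_secant[s1 [t /vec4_inj[<- _ <-]]].
rewrite mul0r mul1r addr0 => /(mulfI (expf_neq0 _ eps_nz)) ->.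
by right; exists d0.
Qed.

Lemma ell1_join al : ell 1 = (L_infty e eps al + P_infty F)%VS.
Proof.
apply/esym/eqP; rewrite eqEdim subv_add -!memvE !mem_ell !eqxx mulr0 mul1r addr0.
rewrite addrr_pchar2 ?char_two // eqxx (is_line_ell _ char_two).
rewrite dim_vline2 ?L_infty_neq0 //; apply/vlineP => -[k].
rewrite vec4Z !mulr1 => /vec4_inj[_ _ <- /eqP].
by rewrite mul0r oner_eq0.
Qed.

Lemma cone_frame_free al : free (cone_frame al).
Proof.
rewrite free_cons seq1_free span_seq1 vec4_eq0 oner_eq0 !andbF andbT.
by apply/vlineP => -[k]; rewrite vec4Z !mulr0 => /vec4_inj[/eqP]; rewrite oner_eq0.
Qed.

Lemma is_line_cone_line al : is_line (cone_line al).
Proof. exact/eqP/cone_frame_free. Qed.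

Lemma mem_cone_line al v : reflect
  (exists s1 t, v = vec4 s1 (s1 * (al * eps)) 0 (s1 * (al ^+ s * eps) + t))
  (v \in cone_line al).
Proof.
rewrite /cone_line span_cons span_seq1.
apply: (iffP (mem_vline2 _ _ _)) => -[s1 [t ->]]; exists s1, t;
  by rewrite !vec4Z vec4D !mulr0 !mulr1 !addr0.
Qed.

Lemma L_infty_notin_cone_line al : ~~ (L_infty e eps al <= cone_line al)%VS.
Proof.
rewrite -memvE; apply/mem_cone_line => -[s1 [t /vec4_inj[_ _ /eqP]]].
by rewrite oner_eq0.
Qed.

Definition cone_plane al : {vspace 'rV[F]_4} := (cone_line al + L_infty e eps al)%VS.

Lemma is_plane_cone_plane al : is_plane (cone_plane al).
Proof.
rewrite /is_plane dimv_add_vline ?is_line_cone_line //.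
by have := L_infty_notin_cone_line al; rewrite -memvE.
Qed.

Lemma cone_base_sub al P : cone_base al P -> (P <= cone_line al)%VS.
Proof.
case=> [->|[d0 _ ->]]; rewrite -memvE; apply/mem_cone_line.
  by exists 0, 1; rewrite !mul0r add0r.
by exists 1, d0; rewrite !mul1r addrC.
Qed.

Lemma cone_linesP al L :
  L \in cone_lines al <-> exists2 R, cone_base al R & L = (L_infty e eps al + R)%VS.
Proof.
rewrite mem_cone_lines; split=> [[->|[d0 d0_in ->]]|[R [->|[d0 d0_in ->]] ->]].
- by exists (P_infty F); [left|exact: ell1_join].
- by exists <[vec4 1 (al * eps) 0 (d0 + al ^+ s * eps)]>%VS => //; right; exists d0.
- by left; rewrite (ell1_join al).
by right; exists d0.
Qed.

(** The Hermitian form is c0 c1^q + c1 c0^q: for c0 <> 0 it vanishes exactly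
    when c1 / c0 is in F_q. *)
Lemma cone_base_hermitian al : hermitian_variety_of_line q (cone_line al) (cone_base al).
Proof.
pose A : 'M[F]_2 := \matrix_(i, j) (i != j)%:R.
exists (cone_frame al), A; split.
- by rewrite /basis_of eqxx cone_frame_free.
- apply/is_hermitianmxP; apply/matrixP => i j; rewrite !mxE expr0 mul1r eq_sym.
  by case: (_ != _); rewrite ?expr1n ?expr0n ?expn_eq0.
- have : A *m A = 1%:M.
    apply/matrixP => i j; rewrite !mxE !big_ord_recr big_ord0 /= !mxE.
    by case: i => [[|[|]]] //= ?; case: j => [[|[|]]] //= ?; rewrite !(mulr0, mulr1, addr0, add0r).
  by case/mulmx1_unit.
have formE (c : 'rV[F]_2) : form_of_matrix (fun x : F => x ^+ q) A c c =
    c 0 1 * c 0 0 ^+ q + c 0 0 * c 0 1 ^+ q.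
  rewrite /form_of_matrix /mxtrace big_ord_recl big_ord0 addr0 mxE.
  rewrite !big_ord_recl !big_ord0 !mxE !big_ord_recl !big_ord0 !mxE /=.
  rewrite !(mulr0, mulr1, addr0, add0r).
  by rewrite (_ : lift ord0 ord0 = 1) //; apply: val_inj.
have sumE (c : 'rV[F]_2) : \sum_i c 0 i *: tnth (cone_frame al) i =
    vec4 (c 0 0) (c 0 0 * (al * eps)) 0 (c 0 0 * (al ^+ s * eps) + c 0 1).
  rewrite !big_ord_recl big_ord0 addr0 /= !vec4Z vec4D !(mulr0, mulr1, addr0).
  by congr (vec4 _ _ _ (_ + c 0 _)); apply: val_inj.
split=> [[->|[d0 d0_in ->]]|[c [c_nz ->]]].
- pose c : 'rV[F]_2 := \row_i (i == 1)%:R.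
  have [c0 c1] : c 0 0 = 0 /\ c 0 1 = 1 by rewrite !mxE.
  exists c; rewrite formE sumE c0 c1 !mul0r add0r addr0; split=> //.
    by apply/eqP => cz; move/eqP: c1; rewrite cz mxE eq_sym oner_eq0.
  by rewrite expr0n expn_eq0 mulr0.
- pose c : 'rV[F]_2 := \row_i if i == 0 then 1 else d0.
  have [c0 c1] : c 0 0 = 1 /\ c 0 1 = d0 by rewrite !mxE.
  exists c; rewrite formE sumE c0 c1 !mul1r; split.
  + by apply/eqP => cz; move/eqP: c0; rewrite cz mxE eq_sym oner_eq0.
  + by rewrite [d0 + _]addrC.
  by rewrite expr1n mulr1 d0_in addrr_pchar2 ?char_two.
rewrite formE sumE; have [c0|c0_nz] := eqVneq (c 0 0) 0.
  have c1_nz : c 0 1 != 0.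
    apply: contraNneq c_nz => c1; apply/eqP/rowP => i; rewrite mxE.
    by case: i => [[|[|//]] lt_i]; [rewrite -[RHS]c0|rewrite -[RHS]c1]; congr (c 0 _); apply: val_inj.
  move=> _; left; rewrite c0 !mul0r add0r.
  by rewrite -[in LHS](mulr1 (c 0 1)) -(mulr0 (c 0 1)) -vec4Z vlineZ.
move=> /eqP; rewrite addr_eq0_char2 => /eqP c_herm; right; exists (c 0 1 / c 0 0).
  rewrite /in_Fq expr_div_n; apply: (mulfI c0_nz).
  by rewrite mulrA -c_herm mulfK ?expf_neq0 // mulrC divfK.
rewrite -[RHS](vlineZ _ c0_nz) vec4Z mulr1 mulr0 mulrDr [c 0 0 * (_ / _)]mulrC divfK //.
by rewrite addrC.
Qed.

Lemma cone_lines_hermitian al :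
  hermitian_cone q (cone_plane al) (L_infty e eps al)
    (fun P => exists2 L : {vspace 'rV[F]_4}, L \in cone_lines al & (P <= L)%VS).
Proof.
split; first exact: is_plane_cone_plane.
- by rewrite /is_point dim_vline L_infty_neq0.
- exact: addvSr.
exists (cone_line al), (cone_base al); split.
- exact: is_line_cone_line.
- exact: addvSl.
- exact: L_infty_notin_cone_line.
- exact: cone_base_hermitian.
move=> P _; split=> [[L /cone_linesP[R baseR ->]]|[R baseR PL]]; first by exists R.
by exists (L_infty e eps al + R)%VS => //; apply/cone_linesP; exists R.
Qed.

(** * The three assertions *)

Lemma line_in_V_through_P_infty L :
  V L /\ (P_infty F <= L)%VS <-> exists2 w, w ^+ (h + 1) = 1 & L = ell w.
Proof.
split=> [[V_L P_L]|[w w_root ->]].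
  case: (line_in_V_cases V_L) => [//|[al [d0 [_ _ def_L]]]].
  move: P_L; rewrite def_L -memvE => /mem_secant[s1 [t /vec4_inj[<- _ <- /eqP]]].
  by rewrite !mul0r addr0 oner_eq0.
split; first exact: line_in_V_ell.
by rewrite -memvE mem_ell mulr0 addr0 eqxx.
Qed.

Lemma nontrivial_rootP w : nontrivial_root e w <-> w ^+ (h + 1) = 1 /\ w <> 1.
Proof. by split=> -[w_root w1]; split=> //; apply/unity_rootP. Qed.

Lemma odd_mod4 : (e %% 4 = 1)%N \/ (e %% 4 = 3)%N.
Proof. by have := e_odd; lia. Qed.

Lemma line_in_V_meets_L_infty L : V L ->
    ((e %% 4 = 3)%N -> forall w, nontrivial_root e w -> L <> ell w) ->
  exists2 al, in_Fq e al & (L_infty e eps al <= L)%VS.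
Proof.
move=> V_L L_neq; case: (line_in_V_cases V_L) => [[w w_root def_L]|[al [d0 [al_in _ ->]]]].
  have w1 : w = 1.
    case: odd_mod4 => [e1|e3]; first exact: unity_mod1 w_root.
    by apply/eqP/negPn/negP => /eqP w1; apply: (L_neq e3 w) def_L; apply/nontrivial_rootP.
  exists 0; first exact: in_Fq0.
  by rewrite def_L w1 -memvE mem_ell eqxx mulr1 addrr_pchar2 ?char_two ?eqxx.
by exists al; rewrite // addvSl.
Qed.

End QuadraticExtension.

Theorem theorem4p2 (e : nat) (F : finFieldType) (eps delta : F)
    (he : (3 <= e)%N) (hodd : odd e) (hF : #|F| = (qe e ^ 2)%N)
    (heps : ~ in_Fq e eps) (hdelta : in_Fq e delta) (hdelta1 : delta <> 1)
    (htr : abs_trace e delta = 1) (heq : eps ^+ 2 + eps + delta = 0) :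
  [/\
      forall L : {vspace 'rV[F]_4}, line_in_V e eps L ->
        ((e %% 4 = 3)%N -> forall w : F, nontrivial_root e w -> L <> ell w) ->
        exists2 alpha : F, in_Fq e alpha & (L_infty e eps alpha <= L)%VS,
      forall alpha : F, in_Fq e alpha ->
        exists (ls : seq {vspace 'rV[F]_4}) (Pi : {vspace 'rV[F]_4}),
          [/\ uniq ls /\ size ls = (qe e).+1,
              forall L : {vspace 'rV[F]_4},
                L \in ls <-> line_in_V e eps L /\ (L_infty e eps alpha <= L)%VS,
              is_plane Pi /\ forall L : {vspace 'rV[F]_4}, L \in ls -> (L <= Pi)%VS,
              ell 1 \in ls &
              hermitian_cone (qe e) Pi (L_infty e eps alpha)
                (fun P => exists2 L : {vspace 'rV[F]_4}, L \in ls & (P <= L)%VS)] &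
      ((e %% 4 = 1)%N -> forall L : {vspace 'rV[F]_4},
         line_in_V e eps L /\ (P_infty F <= L)%VS <-> L = ell 1) /\
      ((e %% 4 = 3)%N -> exists w1 w2 : F,
         [/\ w1 <> w2,
             forall w : F, nontrivial_root e w <-> w = w1 \/ w = w2 &
             forall L : {vspace 'rV[F]_4},
               line_in_V e eps L /\ (P_infty F <= L)%VS <->
               L = ell 1 \/ L = ell w1 \/ L = ell w2])].
Proof.
split.
- by move=> L; apply: (line_in_V_meets_L_infty he hodd hF heps hdelta hdelta1 heq).
- move=> al al_in; exists (cone_lines e eps al), (cone_plane e eps al); split.
  + by split; [exact: uniq_cone_lines | exact: size_cone_lines heq _].
  + by move=> L; exact: (line_in_V_through_L_infty he hodd hF heps hdelta hdelta1 heq).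
  + split=> [|L /(cone_linesP eps hF al L)[R /cone_base_sub R_sub ->]].
      exact: is_plane_cone_plane.
    by rewrite subv_add addvSr (subv_trans R_sub) ?addvSl.
  + by rewrite inE eqxx.
  + exact: cone_lines_hermitian.
split=> [e1 L|e3].
  rewrite (line_in_V_through_P_infty he hodd hF heps hdelta hdelta1 heq).
  by split=> [[w /(unity_mod1 he hodd hF e1) -> //]|->]; exists 1; rewrite ?expr1n.
have [w w_root] := primitive_cube_root he hodd hF hdelta htr heq.
have rootE x : nontrivial_root e x <-> x = w \/ x = w + 1.
  rewrite -(cube_root_neq1 hF x w_root) nontrivial_rootP.
  by have := unity_mod3 he hodd hF x e3; tauto.
exists w, (w + 1); split=> // [/eqP|L].
  by rewrite eq_sym -subr_eq0 addrC addKr oner_eq0.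
rewrite (line_in_V_through_P_infty he hodd hF heps hdelta hdelta1 heq); split.
  move=> [x x_root ->]; have [->|/eqP x1] := eqVneq x 1; first by left.
  have /rootE[->|->] : nontrivial_root e x by apply/nontrivial_rootP.
    by right; left.
  by right; right.
have root1 x : nontrivial_root e x -> exists2 y, y ^+ (2 ^ e.-1./2 + 1) = 1 & ell x = ell y.
  by move=> /nontrivial_rootP[x_root _]; exists x.
case=> [->|[->|->]]; first by exists 1; rewrite ?expr1n.
  by apply/root1/rootE; left.
by apply/root1/rootE; right.
Qed.
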